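(* Let $n\ge 0$ and $j,k\ge 0$ be integers. The number of permutations $\pi$ of $[n]=\{1,\dots,n\}$ that avoid the barred pattern $\overline{3}\overline{1}542$ and have exactly $j+k$ left-to-right maxima, of which exactly $j$ initiate a descent in $\pi$ and exactly $k$ do not, equals $$\binom{n}{k}\, j!\, \left\{ {n-j-k \atop j} \right\},$$ where $\left\{ {m \atop j} \right\}$ denotes the Stirling number of the second kind.
   Context: A permutation $\pi=\pi(1)\cdots\pi(n)$ of $[n]$ avoids the barred pattern $\overline{3}\overline{1}542$ if every occurrence of the pattern $542$ extends to an occurrence of $31542$; explicitly: for all indices $a<b<c$ with $\pi(a)>\pi(b)>\pi(c)$ there exist indices $d<e<a$ with $\pi(e)<\pi(c)<\pi(d)<\pi(b)$. An entry $\pi(i)$ is a left-to-right maximum if $\pi(i)>\pi(h)$ for all $h<i$. A left-to-right maximum $\pi(i)$ initiates a descent if $i<n$ and $\pi(i)>\pi(i+1)$. The Stirling number of the second kind $\left\{ {m \atop j} \right\}$ is the number of partitions of an $m$-element set into $j$ nonempty blocks, with $\left\{ {0 \atop 0} \right\}=1$ and $\left\{ {m \atop j} \right\}=0$ when $m<0$; also $\binom{n}{k}=0$ for $k>n$. *)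

(* Defs.v *)
From mathcomp Require Import all_boot all_fingroup all_order all_algebra.

Set Implicit Arguments.
Unset Strict Implicit.
Unset Printing Implicit Defensive.

(* A permutation of [n] is s : 'S_n, with positions and values both shifted
   down by one; all the notions below depend only on the relative order. *)

Definition avoids_b3b1542 (n : nat) (s : 'S_n) : bool :=
  [forall a : 'I_n, forall b : 'I_n, forall c : 'I_n,
    [&& a < b, b < c, s b < s a & s c < s b] ==>
    [exists d : 'I_n, exists e : 'I_n,
      [&& d < e, e < a, s e < s c, s c < s d & s d < s b]]].

Definition ltr_max (n : nat) (s : 'S_n) (i : 'I_n) : bool :=
  [forall h : 'I_n, (h < i) ==> (s h < s i)].

(* False at the last position, where no i' exists. *)
Definition initiates_descent (n : nat) (s : 'S_n) (i : 'I_n) : bool :=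
  [exists i' : 'I_n, (i' == i.+1 :> nat) && (s i' < s i)].

(* MathComp's partition excludes the empty block. The upper argument is an
   integer because the convention at m < 0 is part of the definition. *)
Definition stirling2 (m : int) (j : nat) : nat :=
  if m is Posz p then
    #|[set P : {set {set 'I_p}} | partition P [set: 'I_p] & #|P| == j]|
  else 0.

(* Main.v *)
(* Call a left-to-right maximum flat if it does not initiate a descent. A flat
   maximum v must stand just before the first larger entry (or at the end), so
   any value v can be inserted as a flat maximum in exactly one position, and
   this insertion changes neither avoidance nor the other maxima. Counting
   permutations with one marked flat maximum reduces the theorem to k = 0 with
   the factor 'C(n, k).

   For k = 0, delete the last entry of the permutation. What remains is an
   avoider in which only a maximum in last position may be flat; conversely,
   the last entry c can be re-appended exactly when the entry immediately above
   c in value is one of the j left-to-right maxima. If the new last entry of the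
   remainder is a flat maximum it is the greatest value, and can be deleted too.
   So the count a(n, j) satisfies a(n+2, j+1) = (j+1) (a(n+1, j+1) + a(n, j)),
   the recurrence of j! S(n-j, j). *)
Require Import Defs.
From mathcomp Require Import all_boot all_fingroup all_order all_algebra.
From mathcomp Require Import zify.

Set Implicit Arguments.
Unset Strict Implicit.
Unset Printing Implicit Defensive.

(** * Indicator sums, and permutations split at one position *)

Lemma card_set_sum (T : finType) (P : pred T) : #|[set x | P x]| = \sum_x P x.
Proof.
by rewrite -sum1dep_card big_mkcond; apply: eq_bigr => x _; case: (P x).
Qed.

Lemma card_set_lift n (p : 'I_n.+1) (P : pred 'I_n.+1) :
  #|[set i | P i]| = P p + #|[set i | P (lift p i)]|.
Proof. by rewrite !card_set_sum (bigD1_ord p). Qed.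

(** Injectivity suffices, as both sides have (n+1)! elements. With [p] fixed, every permutation thus
    arises exactly once by inserting a value [v] at [p]. *)
Lemma lift_perm_bij n (p : 'I_n.+1) :
  bijective (fun vs : 'I_n.+1 * 'S_n => lift_perm p vs.1 vs.2).
Proof.
apply: inj_card_bij => [[v s] [w t] /= E|]; last first.
  have cS m : #|{: 'S_m}| = m`! by rewrite -card_Sn; apply: eq_card => s; rewrite !inE.
  by rewrite card_prod !cS card_ord factS.
have vw : v = w by rewrite -(lift_perm_id p v s) E lift_perm_id.
rewrite {}vw in E *; congr (_, _); apply/permP => i; apply: (@lift_inj _ w).
by rewrite -!(lift_perm_lift p) E.
Qed.

Lemma sum_lift_perm n (p : 'I_n.+1) (F : 'S_n.+1 -> nat) :
  \sum_s F s = \sum_v \sum_s F (lift_perm p v s).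
Proof. by rewrite (reindex _ (onW_bij _ (lift_perm_bij p))) pair_bigA. Qed.

Variant lift_spec n (h : 'I_n.+1) : 'I_n.+1 -> Type :=
  | LiftOf (j : 'I_n) : lift_spec h (lift h j)
  | LiftHole : lift_spec h h.

Lemma liftP n (h i : 'I_n.+1) : lift_spec h i.
Proof. by case: (unliftP h i) => [j|] ->; [apply: LiftOf | apply: LiftHole]. Qed.

Lemma ltn_lift2 n (h : 'I_n.+1) (i j : 'I_n) : (lift h i < lift h j) = (i < j).
Proof. by rewrite /= !ltnNge leq_bump2. Qed.

Lemma ltn_lift_l n (h : 'I_n.+1) (i : 'I_n) : (lift h i < h) = (i < h).
Proof. by rewrite /= /bump; lia. Qed.

Lemma ltn_lift_r n (h : 'I_n.+1) (i : 'I_n) : (h < lift h i) = (h <= i).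
Proof. by rewrite /= /bump; lia. Qed.

Definition ltn_liftE := (ltn_lift2, ltn_lift_l, ltn_lift_r).

(** * The notions of the theorem in propositional form *)

Lemma ltr_maxP n (s : 'S_n) (i : 'I_n) :
  reflect (forall h : 'I_n, h < i -> s h < s i) (ltr_max s i).
Proof.
by apply: (iffP forallP) => H h; [move=> hi; apply: (implyP (H h)) | apply/implyP/H].
Qed.

Lemma initiates_descentP n (s : 'S_n) (i : 'I_n) :
  reflect (exists2 i' : 'I_n, i' = i.+1 :> nat & s i' < s i) (initiates_descent s i).
Proof.
apply: (iffP existsP) => [[i' /andP[/eqP ? ?]]|[i' ? ?]]; exists i' => //.
by apply/andP; split => //; apply/eqP.
Qed.

Lemma avoidsP n (s : 'S_n) :
  reflect (forall a b c : 'I_n, a < b -> b < c -> s b < s a -> s c < s b ->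
             exists d e : 'I_n, [/\ d < e, e < a, s e < s c, s c < s d & s d < s b])
          (avoids_b3b1542 s).
Proof.
apply: (iffP forallP) => H a.
  move=> b c ab bc sba scb.
  have /forallP/(_ c) := forallP (H a) b.
  rewrite ab bc sba scb => /existsP[d /existsP[e /and5P[*]]].
  by exists d, e.
apply/forallP => b; apply/forallP => c; apply/implyP => /and4P[ab bc sba scb].
have [d [e [*]]] := H a b c ab bc sba scb.
by apply/existsP; exists d; apply/existsP; exists e; apply/and5P.
Qed.

(** * Inserting a flat maximum *)

Definition flat_ltr_max n (s : 'S_n) i := ltr_max s i && ~~ initiates_descent s i.

(* The position p just before the first value of s that is at least v; values
   at least v move up by one when v is inserted by lift_perm p v s. *)
Definition fits n (s : 'S_n) (p v : 'I_n.+1) :=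
  [forall i : 'I_n, (i < p) ==> (s i < v)] && [forall i : 'I_n, (i == p :> nat) ==> (v <= s i)].

Lemma fitsP n (s : 'S_n) (p v : 'I_n.+1) :
  reflect ((forall i : 'I_n, i < p -> s i < v) /\ (forall i : 'I_n, i = p :> nat -> v <= s i))
          (fits s p v).
Proof.
apply: (iffP andP) => [[/forallP H1 /forallP H2]|[H1 H2]]; split.
- by move=> i; apply/implyP.
- by move=> i /eqP; apply/implyP.
- by apply/forallP => i; apply/implyP/H1.
- by apply/forallP => i; apply/implyP => /eqP; apply: H2.
Qed.

(** The value 1 packs existence and uniqueness: the position is that of the first entry at least
    [v], or the end if there is none. *)
Lemma fits_exists n (s : 'S_n) (v : 'I_n.+1) : \sum_p fits s p v = 1.
Proof.
have [p Hp] : exists p, fits s p v.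
  case: (pickP (fun i : 'I_n => v <= s i)) => [i0 vi0|none].
    case: (@arg_minnP _ i0 (fun i : 'I_n => v <= s i) (@nat_of_ord n) vi0) => i vi imin.
    exists (lift ord_max i); apply/fitsP; rewrite lift_max.
    split=> [j ji|j /ord_inj->] //.
    by rewrite ltnNge; apply: contraL ji => /imin; rewrite -leqNgt.
  exists ord_max; apply/fitsP; split=> i /= Hi.
    by rewrite ltnNge none.
  by have := ltn_ord i; rewrite Hi ltnn.
rewrite (bigD1 p) //= Hp big1 // => q qp; apply/eqP; rewrite eqb0.
apply: contra qp => /fitsP[q1 q2]; have [p1 p2] := fitsP _ _ _ Hp.
(* Of two distinct fitting positions, the smaller would hold an entry both at least [v] and below
   [v]. *)
apply/eqP/val_inj/eqP; rewrite eqn_leq; apply/andP; split; rewrite leqNgt; apply/negP => lt.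
  have pn : p < n by move: (ltn_ord q) lt => /=; lia.
  by have := q1 (Ordinal pn) lt; rewrite ltnNge (p2 (Ordinal pn)).
have qn : q < n by move: (ltn_ord p) lt => /=; lia.
by have := p1 (Ordinal qn) lt; rewrite ltnNge (q2 (Ordinal qn)).
Qed.

Lemma ltr_max_lift_id n (s : 'S_n) (p v : 'I_n.+1) :
  reflect (forall i : 'I_n, i < p -> s i < v) (ltr_max (lift_perm p v s) p).
Proof.
apply: (iffP (ltr_maxP _ _)) => H i.
  by have := H (lift p i); rewrite lift_perm_lift lift_perm_id !ltn_liftE.
case: (liftP p i) => [j|]; last by rewrite ltnn.
by rewrite lift_perm_lift lift_perm_id !ltn_liftE; apply: H.
Qed.

Lemma ltr_max_lift n (s : 'S_n) (p v : 'I_n.+1) i :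
  ltr_max (lift_perm p v s) (lift p i) = ltr_max s i && ((p <= i) ==> (v <= s i)).
Proof.
apply/ltr_maxP/andP => [H|[/ltr_maxP H1 /implyP H2] h].
  split; [apply/ltr_maxP => h|apply/implyP].
    by have := H (lift p h); rewrite !lift_perm_lift !ltn_liftE.
  by have := H p; rewrite lift_perm_lift lift_perm_id !ltn_liftE.
case: (liftP p h) => [j|]; rewrite !lift_perm_lift ?lift_perm_id !ltn_liftE //.
exact: H1.
Qed.

Lemma ltr_max_mono n (s : 'S_n) (i j : 'I_n) : ltr_max s j -> i <= j -> s i <= s j.
Proof.
move=> /ltr_maxP H; rewrite leq_eqVlt => /orP[/eqP/ord_inj->//|/H].
exact: ltnW.
Qed.

(** A maximum of [s] at or after [p] is at least the entry at [p], hence at least [v], so the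
    inserted entry does not overtop it. *)
Lemma fits_ltr_max n (s : 'S_n) (p v : 'I_n.+1) i : fits s p v ->
  ltr_max (lift_perm p v s) (lift p i) = ltr_max s i.
Proof.
move=> /fitsP[_ pv]; rewrite ltr_max_lift.
have [Hi|//] := boolP (ltr_max s i); apply/implyP => le.
have pn : p < n by move: (ltn_ord i); lia.
have vp : v <= s (Ordinal pn) by apply: pv.
exact: leq_trans vp (@ltr_max_mono _ _ (Ordinal pn) i Hi le).
Qed.

(** The first clause of [fits] makes the inserted entry a maximum; the second rules out a descent
    from it. *)
Lemma flat_ltr_max_lift_id n (s : 'S_n) (p v : 'I_n.+1) :
  flat_ltr_max (lift_perm p v s) p = fits s p v.
Proof.
rewrite /flat_ltr_max; apply/andP/fitsP => -[H1 H2]; split.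
- exact/ltr_max_lift_id.
- move=> i ip; rewrite leqNgt; apply: contra H2 => lt.
  apply/initiates_descentP; exists (lift p i); first by rewrite /= /bump ip leqnn.
  by rewrite lift_perm_lift lift_perm_id ltn_liftE.
- exact/ltr_max_lift_id.
- apply/initiates_descentP => -[i].
  case: (liftP p i) => [j|]; last by rewrite ltnn.
  rewrite lift_perm_lift lift_perm_id ltn_liftE /= /bump => E.
  by rewrite ltnNge H2 //; move: E; case: leqP; lia.
Qed.

(** Only the entry just before [p] gets a new successor. It is below [v], and [v] is at most the
    entry of [s] at [p], so it initiates a descent neither before nor after the insertion. *)
Lemma fits_initiates_descent n (s : 'S_n) (p v : 'I_n.+1) i : fits s p v -> ltr_max s i ->
  initiates_descent (lift_perm p v s) (lift p i) = initiates_descent s i.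
Proof.
move=> /fitsP[pv1 pv2] Hi.
apply/initiates_descentP/initiates_descentP => -[i'].
  case: (liftP p i') => [j|].
    rewrite !lift_perm_lift ltn_lift2 => E lt; exists j => //.
    by move: E; rewrite /= /bump; have := pv2 j; do 2 case: leqP; lia.
  rewrite lift_perm_lift lift_perm_id ltn_lift_r leqNgt => E.
  by rewrite pv1 //; move: E; rewrite /= /bump; case: leqP; lia.
move=> E lt; exists (lift p i'); last by rewrite !lift_perm_lift ltn_lift2.
rewrite /= /bump E; have [ip|] := eqVneq i.+1 p; last by lia.
have := pv2 i' (etrans E ip); have := pv1 i; rewrite ip leqnn => /(_ isT); lia.
Qed.

(** The inserted entry exceeds all entries before it, so it cannot be the 1, 4 or 2 of a 31542. As
    the 5 it can be replaced by the entry after it, which stays above the 4. The delicate role is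
    that of the 3. *)
Lemma fits_avoids n (s : 'S_n) (p v : 'I_n.+1) : fits s p v ->
  avoids_b3b1542 (lift_perm p v s) = avoids_b3b1542 s.
Proof.
move=> F; have [pv1 pv2] := fitsP _ _ _ F.
have maxp : ltr_max (lift_perm p v s) p by case/fitsP: F => ? _; apply/ltr_max_lift_id.
apply/avoidsP/avoidsP => H a b c.
  move=> ab bc sba scb.
  (* The first entry is left open because the argument may restart from a larger one. *)
  pose occ x := H (lift p x) (lift p b) (lift p c).
  have lt2 := (lift_perm_lift, ltn_lift2).
  have := occ a; rewrite !lt2 => /(_ ab bc sba scb) [d [e [de ea]]].
  case: (liftP p e) ea de => [e'|]; last first.
    by move=> _ dp ? ?; have := ltr_maxP _ _ maxp d dp; lia.
  case: (liftP p d) => [d'|] ea de; rewrite !lt2 in ea * => se sd sdb.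
    by rewrite ltn_lift2 in de; exists d', e'.
  rewrite lift_perm_id ltn_lift_l in sd; rewrite lift_perm_id ltn_lift_r in sdb.
  rewrite ltn_lift_r in de.
  (* The inserted value plays the role of d: replace it by the entry q after
     it, or, if q is too large, use the occurrence of 542 starting at q. *)
  have pn : p < n := leq_ltn_trans de (ltn_ord e').
  pose q := Ordinal pn; have vq : v <= s q by apply: pv2.
  have qe : q < e'.
    by rewrite ltn_neqAle de andbT; apply/eqP => /ord_inj E; rewrite -E in se; lia.
  have [sqb|] := ltnP (s q) (s b); first by exists q, e'; split=> //; lia.
  rewrite leq_eqVlt => /orP[/eqP/ord_inj/perm_inj bq|sqb]; first by subst b; lia.
  have qb : q < b by lia.
  have := occ q; rewrite !lt2 => /(_ qb bc sqb scb) [d2 [e2 [de2 eq]]].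
  case: (liftP p e2) eq de2 => [e3|]; last first.
    by move=> _ dp ? ?; have := ltr_maxP _ _ maxp d2 dp; lia.
  case: (liftP p d2) => [d3|]; rewrite !lt2.
    by move=> e3q d3e se3 sd3 sd3b; exists d3, e3; split => //; lia.
  (* Were the inserted entry the 3 again, the 1 would lie strictly between it and [q], its immediate
     successor. *)
  by rewrite ltn_lift_r => e3q pe; move: e3q pe => /=; lia.
case: (liftP p b) => [b'|] ab; last by have := ltr_maxP _ _ maxp a ab; lia.
case: (liftP p c) => [c'|] bc; last first.
  have ap := ltn_trans ab bc; have := ltr_maxP _ _ maxp a ap; lia.
have lt2 := (lift_perm_lift, ltn_lift2); rewrite !lt2 in bc *.
case: (liftP p a) ab => [a'|] ab.
  rewrite !lt2 in ab * => sba scb.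
  have [d [e [de ea se sd sdb]]] := H a' b' c' ab bc sba scb.
  by exists (lift p d), (lift p e); rewrite !lt2.
rewrite lift_perm_id ltn_lift_l => sbv scb; rewrite ltn_lift_r in ab.
have pn : p < n := leq_ltn_trans ab (ltn_ord b').
pose q := Ordinal pn; have vq : v <= s q by apply: pv2.
have sbq : s b' < s q by apply: leq_trans vq.
have qb : q < b'.
  by rewrite ltn_neqAle ab andbT; apply/eqP => /ord_inj E; rewrite E ltnn in sbq.
have [d [e [de ea se sd sdb]]] := H q b' c' qb bc sbq scb.
by exists (lift p d), (lift p e); rewrite !lt2 ltn_lift_l.
Qed.

(** * Reduction to permutations without flat maxima *)

Definition typed n j k (s : 'S_n) :=
  [&& avoids_b3b1542 s,
    #|[set i | ltr_max s i & initiates_descent s i]| == j &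
    #|[set i | flat_ltr_max s i]| == k].

Definition num_typed n j k := \sum_(s : 'S_n) typed j k s.

Lemma fits_flat_ltr_max n (s : 'S_n) (p v : 'I_n.+1) i : fits s p v ->
  flat_ltr_max (lift_perm p v s) (lift p i) = flat_ltr_max s i.
Proof.
move=> F; rewrite /flat_ltr_max fits_ltr_max //.
by have [Hi|//] := boolP (ltr_max s i); rewrite fits_initiates_descent.
Qed.

Lemma fits_typed n j k (s : 'S_n) (p v : 'I_n.+1) : fits s p v ->
  typed j k.+1 (lift_perm p v s) = typed j k s.
Proof.
move=> F; have := flat_ltr_max_lift_id s p v; rewrite F => flatp.
rewrite /typed fits_avoids // !(card_set_lift p) flatp add1n eqSS.
have -> : ltr_max (lift_perm p v s) p && initiates_descent (lift_perm p v s) p = false.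
  by case/andP: flatp => _ /negPf->; rewrite andbF.
rewrite add0n; congr (_ && _); congr (_ && _); congr (_ == _); apply: eq_card => i; rewrite !inE ?fits_flat_ltr_max //.
rewrite fits_ltr_max //.
by have [Hi|//] := boolP (ltr_max s i); rewrite fits_initiates_descent.
Qed.

(** Both sides count permutations with one marked flat maximum: there are k+1 ways to mark, while
    deleting the marked entry leaves its value, n+1 choices, and a smaller permutation; the position
    is then forced. *)
Lemma num_typedS n j k : k.+1 * num_typed n.+1 j k.+1 = n.+1 * num_typed n j k.
Proof.
transitivity (\sum_(p < n.+1) \sum_(s : 'S_n.+1) (typed j k.+1 s && flat_ltr_max s p)).
  rewrite /num_typed big_distrr exchange_big; apply: eq_bigr => s _ /=.
  have [ty|_] := boolP (typed j k.+1 s); last by rewrite muln0 big1.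
  by rewrite -card_set_sum; case/and3P: ty => _ _ /eqP->; rewrite muln1.
transitivity (\sum_(v < n.+1) \sum_(s : 'S_n) \sum_(p < n.+1) (typed j k s && fits s p v)).
  under eq_bigr => p _ do rewrite (sum_lift_perm p).
  rewrite exchange_big; apply: eq_bigr => v _ /=.
  rewrite exchange_big; apply: eq_bigr => s _ /=.
  apply: eq_bigr => p _; rewrite flat_ltr_max_lift_id.
  by have [/fits_typed->|] := boolP (fits s p v); rewrite ?andbF.
rewrite -[n.+1 in RHS]card_ord -sum_nat_const; apply: eq_bigr => v _.
apply: eq_bigr => s _.
by have [ty|_] := boolP (typed j k s); [apply: fits_exists | rewrite big1].
Qed.

Lemma num_typed_bin n j k : num_typed n j k = 'C(n, k) * num_typed (n - k) j 0.
Proof.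
elim: k n => [|k IH] n; first by rewrite bin0 mul1n subn0.
case: n => [|n].
  rewrite bin0n mul0n /num_typed big1 // => s _; rewrite /typed.
  have -> : #|[set i | flat_ltr_max s i]| = 0 by apply: eq_card0 => -[].
  by rewrite !andbF.
apply/eqP; rewrite -(eqn_pmul2l (ltn0Sn k)) num_typedS IH subSS !mulnA.
by rewrite mul_bin_diag.
Qed.

(** * No flat maxima: deleting the last entry *)

Lemma card_ltr_max n (s : 'S_n) :
  #|[set i | ltr_max s i]| =
  #|[set i | ltr_max s i & initiates_descent s i]| + #|[set i | flat_ltr_max s i]|.
Proof.
rewrite -(cardsID [set i | initiates_descent s i]).
by congr (_ + _); apply: eq_card => i; rewrite !inE // andbC.
Qed.

Lemma typed0E n j (s : 'S_n) : typed j 0 s =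
  [&& avoids_b3b1542 s, #|[set i | ltr_max s i]| == j & [forall i, ~~ flat_ltr_max s i]].
Proof.
rewrite /typed card_ltr_max; congr (_ && _).
have -> : [forall i, ~~ flat_ltr_max s i] = (#|[set i | flat_ltr_max s i]| == 0).
  rewrite cards_eq0; apply/forallP/eqP => [H|H i].
    by apply/setP => i; rewrite !inE; apply/negbTE.
  by have := in_set0 i; rewrite -H inE => ->.
by case: (#|[set i | flat_ltr_max s i]| =P 0) => [->|]; rewrite ?addn0 ?andbF.
Qed.

(** A maximum whose descent led to the deleted last entry becomes flat, but then stands last; this
    is the only flat maximum the deletion can create. *)
Definition flat_only_last n (s : 'S_n) := [forall i, flat_ltr_max s i ==> (i.+1 == n)].

Definition extendable n j (s : 'S_n) :=
  [&& avoids_b3b1542 s, #|[set i | ltr_max s i]| == j & flat_only_last s].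

Lemma fits_last n (s : 'S_n) : fits s ord_max ord_max.
Proof. by apply/fitsP; split=> i /= Hi; move: (ltn_ord i) (ltn_ord (s i)); lia. Qed.

Lemma ltr_max_last n (s : 'S_n) (v : 'I_n.+1) :
  ltr_max (lift_perm ord_max v s) ord_max = (v == ord_max).
Proof.
apply/ltr_max_lift_id/eqP => [H|-> i _]; last exact: ltn_ord.
apply/val_inj/eqP; rewrite eqn_leq leq_ord leqNgt /=; apply/negP => vn.
(* The entry of [s] with value [v] is shifted above the new last entry. *)
have := H (s^-1 (Ordinal vn))%g; rewrite permKV /= ltnn => contra.
by have := contra (ltn_ord _).
Qed.

Lemma ltr_max_lift_last n (s : 'S_n) (v : 'I_n.+1) i :
  ltr_max (lift_perm ord_max v s) (lift ord_max i) = ltr_max s i.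
Proof. by rewrite ltr_max_lift leqNgt ltn_ord andbT. Qed.

Lemma flat_ltr_max_lift_last n (s : 'S_n) (v : 'I_n.+1) i : v < n ->
  flat_ltr_max (lift_perm ord_max v s) (lift ord_max i) = flat_ltr_max s i && (i.+1 != n).
Proof.
move=> vn; rewrite /flat_ltr_max ltr_max_lift_last.
have [Hi|//] := boolP (ltr_max s i); rewrite /= -negb_or; congr (~~ _).
apply/initiates_descentP/orP.
  move=> [i']; case: (liftP ord_max i') => [j|].
    rewrite !lift_perm_lift ltn_lift2 !lift_max => E lt; left.
    by apply/initiates_descentP; exists j.
  by rewrite lift_max => /= <- _; right.
case=> [/initiates_descentP[j E lt]|/eqP E].
  exists (lift ord_max j); first by rewrite !lift_max.
  by rewrite !lift_perm_lift ltn_lift2.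
exists ord_max; first by rewrite lift_max.
rewrite lift_perm_lift lift_perm_id ltn_lift_r.
(* Since [v] is itself a value of [s], it is at most the maximum in last position. *)
rewrite -{1}[nat_of_ord v]/(nat_of_ord (Ordinal vn)) -[Ordinal vn](permKV s).
apply: ltr_max_mono Hi _; by rewrite -ltnS E.
Qed.

(** The appended entry can only be the 2 of a 542. The entry of [s] with value [v] becomes [v]+1,
    just above it, and serves as the 3 exactly when it is a maximum. *)
Lemma avoids_lift_last n (s : 'S_n) (v : 'I_n.+1) : v < n -> flat_only_last s ->
  avoids_b3b1542 (lift_perm ord_max v s) =
  avoids_b3b1542 s && [exists i, ltr_max s i && (lift ord_max (s i) == v)].
Proof.
move=> vn /forallP only; have lt2 := (lift_perm_lift, ltn_lift2).
have lift_ltn (x y : 'I_n.+1) : x < y -> exists x' : 'I_n, x = lift ord_max x'.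
  by case: (liftP ord_max x) => [x'|] xy; [exists x' | move: (ltn_ord y) xy => /=; lia].
apply/avoidsP/andP => [H|[/avoidsP H /existsP[i /andP[Hi /eqP siv]]]].
  split.
    apply/avoidsP => a b c ab bc sba scb.
    have := H (lift ord_max a) (lift ord_max b) (lift ord_max c); rewrite !lt2.
    move=> /(_ ab bc sba scb) [d [e [de ea]]].
    have [e' ?] := lift_ltn _ _ ea; have [d' ?] := lift_ltn _ _ de; subst d e.
    by rewrite !lt2 in de ea * => *; exists d', e'.
  pose i := (s^-1 (Ordinal vn))%g; have si : s i = v :> nat by rewrite permKV.
  apply/existsP; exists i; apply/andP; split; last first.
    by apply/eqP/ord_inj; rewrite lift_max.
  apply/ltr_maxP => h hi; rewrite ltnNge leq_eqVlt; apply/negP.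
  case/orP => [/eqP/ord_inj/perm_inj E|lt]; first by rewrite E ltnn in hi.
  (* In this 542 the 4 and the 2 have consecutive values, so no 3 fits between them. *)
  rewrite si in lt; have := H (lift ord_max h) (lift ord_max i) ord_max.
  rewrite !lt2 lift_perm_id ltn_lift_l ltn_lift_r si.
  move=> /(_ hi (ltn_ord i) lt (leqnn v)) [d [e [de ea _]]].
  have [d' ?] := lift_ltn _ _ de; subst d; rewrite !lt2 ltn_lift_r => ?; lia.
move=> a b c ab bc.
have [b' ?] := lift_ltn _ _ bc; have [a' ?] := lift_ltn _ _ ab; subst a b.
rewrite !lt2 in ab * => sba.
case: (liftP ord_max c) bc => [c'|] bc; rewrite ?lt2 in bc *.
  move=> scb; have [d [e [*]]] := H a' b' c' ab bc sba scb.
  by exists (lift ord_max d), (lift ord_max e); rewrite !lt2.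
have siv' : s i = v :> nat by rewrite -siv lift_max.
rewrite lift_perm_id ltn_lift_r -siv' leq_eqVlt.
case/orP => [/eqP/ord_inj/perm_inj E|sib].
  by subst b'; have := ltr_max_mono Hi (ltnW ab); lia.
have ia : i < a' by rewrite ltnNge; apply/negP => /(ltr_max_mono Hi); lia.
(* As [i] precedes [a'] it is not last, hence not flat: it is the 3, and its smaller successor is
   the 1. *)
have /implyP := only i; rewrite /flat_ltr_max Hi /=.
have [/initiates_descentP[e ei sei] _|_ /(_ isT)/eqP] := boolP (initiates_descent s i); last first.
  by move: (ltn_ord a'); lia.
have ea : e < a'.
  rewrite ltn_neqAle ei ia andbT; apply/eqP => E; move: sei.
  rewrite ltnNge => /negP; apply; have -> : e = a' by apply: ord_inj; rewrite ei.
  exact/ltnW/(ltn_trans sib).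
exists (lift ord_max i), (lift ord_max e); rewrite !lt2 siv' ltn_lift_l ltn_lift_r -siv'.
by split=> //; rewrite ei.
Qed.

(** Appending the greatest value would create a flat maximum. Any other value turns a maximum in
    last position into one that initiates a descent. *)
Lemma typed0_lift_last n j (s : 'S_n) (v : 'I_n.+1) :
  typed j 0 (lift_perm ord_max v s) =
  extendable j s && [exists i, ltr_max s i && (lift ord_max (s i) == v)].
Proof.
rewrite typed0E /extendable.
have [vn|nv] := ltnP v n; last first.
  have -> : v = ord_max by apply/val_inj/eqP; rewrite eqn_leq leq_ord.
  have -> : [exists i, ltr_max s i && (lift ord_max (s i) == ord_max)] = false.
    by apply/existsP => -[i]; rewrite lift_eqF andbF.
  rewrite !andbF; apply/and3P => -[_ _ /forallP/(_ ord_max)/negP[]].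
  by rewrite flat_ltr_max_lift_id fits_last.
have -> : [forall i, ~~ flat_ltr_max (lift_perm ord_max v s) i] = flat_only_last s.
  apply/forallP/forallP => H i.
    have := H (lift ord_max i); rewrite flat_ltr_max_lift_last // negb_and negbK.
    by rewrite implybE.
  case: (liftP ord_max i) => [i'|].
    by rewrite flat_ltr_max_lift_last // negb_and negbK -implybE.
  by rewrite /flat_ltr_max ltr_max_last -val_eqE /= ltn_eqF.
have vmax : (v == ord_max) = false by rewrite -val_eqE /= ltn_eqF.
rewrite (card_set_lift ord_max) ltr_max_last vmax add0n.
have -> : #|[set i | ltr_max (lift_perm ord_max v s) (lift ord_max i)]| =
          #|[set i | ltr_max s i]|.
  by apply: eq_card => i; rewrite !inE ltr_max_lift_last.
have [ol|_] := boolP (flat_only_last s); last by rewrite !andbF.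
by rewrite avoids_lift_last // !andbT andbAC.
Qed.

(** The maxima have distinct values, so each extendable permutation admits exactly [j] last
    entries. *)
Lemma num_typed0S n j : num_typed n.+1 j 0 = j * \sum_(s : 'S_n) extendable j s.
Proof.
rewrite /num_typed (sum_lift_perm ord_max) exchange_big big_distrr.
apply: eq_bigr => s _ /=; under eq_bigr => v _ do rewrite typed0_lift_last.
have [ex|_] := boolP (extendable j s); last by rewrite big1 ?muln0.
rewrite -card_set_sum muln1; case/and3P: ex => _ /eqP<- _.
rewrite -(card_imset (mem [set i | ltr_max s i]) (inj_comp (@lift_inj _ ord_max) (@perm_inj _ s))).
apply: eq_card => v; rewrite inE; apply/existsP/imsetP => [[i /andP[Hi /eqP<-]]|[i]].
  by exists i; rewrite ?inE.
by rewrite inE => Hi ->; exists i; rewrite Hi /=.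
Qed.

(** Either no maximum is flat, or the last entry is a flat maximum, hence the greatest value;
    deleting it loses one maximum and leaves none flat. *)
Lemma num_extendable n j :
  \sum_(s : 'S_n.+1) extendable j.+1 s = num_typed n.+1 j.+1 0 + num_typed n j 0.
Proof.
transitivity (\sum_(s : 'S_n.+1) (typed j.+1 0 s + (extendable j.+1 s && flat_ltr_max s ord_max))).
  apply: eq_bigr => s _; rewrite typed0E /extendable.
  have [fl|nfl] := boolP (flat_ltr_max s ord_max).
    have -> : [forall i, ~~ flat_ltr_max s i] = false.
      by apply/forallP => /(_ ord_max); rewrite fl.
    by rewrite !andbF andbT.
  rewrite andbF addn0; congr (nat_of_bool (_ && (_ && _))).
  apply/forallP/forallP => H i; last by rewrite (negPf (H i)).
  have := H i; rewrite eqSS; case: eqVneq => [E|_]; last by rewrite implybF.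
  by move=> _; have -> : i = ord_max by apply: val_inj.
rewrite big_split /=; congr (_ + _).
rewrite (sum_lift_perm ord_max) (bigD1 ord_max) //= [X in _ + X]big1 ?addn0.
  apply: eq_bigr => s _; rewrite flat_ltr_max_lift_id.
  have F := fits_last s.
  rewrite F andbT typed0E /extendable fits_avoids // (card_set_lift ord_max).
  rewrite ltr_max_last eqxx add1n eqSS.
  have -> : #|[set i | ltr_max (lift_perm ord_max ord_max s) (lift ord_max i)]| =
          #|[set i | ltr_max s i]|.
    by apply: eq_card => i; rewrite !inE ltr_max_lift_last.
  congr (nat_of_bool (_ && (_ && _))); apply/forallP/forallP => H i.
    have := H (lift ord_max i); rewrite fits_flat_ltr_max // lift_max eqSS.
    by rewrite ltn_eqF // implybF.
  by case: (liftP ord_max i) => [i'|]; rewrite ?eqxx ?implybT // fits_flat_ltr_max // (negPf (H i')).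
move=> v vm; apply: big1 => s _.
by rewrite /flat_ltr_max ltr_max_last (negPf vm) andbF.
Qed.

(** * Set partitions and the Stirling recurrence *)

Lemma card_can_in (T U : finType) (A : {set T}) (B : {set U}) (f : T -> U) (g : U -> T) :
  (forall x, x \in A -> f x \in B /\ g (f x) = x) ->
  (forall y, y \in B -> g y \in A /\ f (g y) = y) -> #|A| = #|B|.
Proof.
move=> fP gP; rewrite -(card_in_imset (f := f) (D := mem A)).
  apply: eq_card => y; apply/imsetP/idP => [[x Ax ->]|By]; first by case: (fP x Ax).
  by have [gA fg] := gP y By; exists (g y).
by apply: (can_in_inj (g := g)) => x Ax; case: (fP x Ax).
Qed.

(** The ground set [D] is a subset of a fixed type, so that induction can remove an element without
    changing the type. *)
Definition partitions (T : finType) (D : {set T}) j : {set {set {set T}}} :=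
  [set P | partition P D & #|P| == j].

(** Removing the block [[set x]] and adding it back are inverse. *)
Lemma card_partitions_with_singleton (T : finType) (x : T) (D : {set T}) j : x \notin D ->
  #|[set Q in partitions (x |: D) j.+1 | [set x] \in Q]| = #|partitions D j|.
Proof.
move=> xD.
apply: (card_can_in (f := fun Q => Q :\ [set x]) (g := fun P => [set x] |: P)) => Q.
  rewrite !inE => /andP[/andP[pQ cQ] xQ]; rewrite setD1K //; split=> //.
  have := partitionD1 pQ xQ; rewrite setU1K // => ->.
  by move: cQ; rewrite (cardsD1 [set x]) xQ.
rewrite !inE => /andP[pQ cQ].
have xQ : [set x] \notin Q.
  by apply: contra xD => xQ; have := partitionS pQ xQ; rewrite sub1set.
rewrite setU1K // eqxx orTb andbT cardsU1 xQ add1n eqSS cQ andbT; split=> //.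
apply: partitionU1 => //; first by apply/set0Pn; exists x; rewrite inE.
by rewrite disjoints1.
Qed.

(* Such a partition of x |: D is a partition of D with a chosen block, to which
   x is added. *)
Lemma card_partitions_without_singleton (T : finType) (x : T) (D : {set T}) j : x \notin D ->
  #|[set Q in partitions (x |: D) j.+1 | [set x] \notin Q]| = j.+1 * #|partitions D j.+1|.
Proof.
move=> xD.
pose X := [set PB : {set {set T}} * {set T} | (PB.1 \in partitions D j.+1) && (PB.2 \in PB.1)].
transitivity #|X|; last first.
  rewrite card_set_sum -(pair_bigA _ (fun P B => (P \in partitions D j.+1) && (B \in P) : nat)) /=.
  rewrite -sum1_card big_distrr [RHS]big_mkcond; apply: eq_bigr => P _ /=.
  have [|_] := boolP (P \in _); last by rewrite big1.
  rewrite inE muln1 => /andP[_ /eqP <-].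
  by rewrite -sum1_card [RHS]big_mkcond; apply: eq_bigr => B _; case: (B \in P).
apply/esym; apply: (card_can_in
  (f := fun PB => (x |: PB.2) |: (PB.1 :\ PB.2))
  (g := fun Q => ((pblock Q x :\ x) |: (Q :\ pblock Q x), pblock Q x :\ x))).
  case=> P B; rewrite !inE /= => /andP[/andP[pP cP] BP].
  have BD := partitionS pP BP.
  have xB : x \notin B by apply: contra xD; apply: (subsetP BD).
  have xBP : (x |: B) \notin P :\ B.
    rewrite !inE negb_and; apply/orP; right; apply: contra xD => xBP.
    by apply: (subsetP (partitionS pP xBP)); rewrite !inE eqxx.
  have pf : partition ((x |: B) |: (P :\ B)) (x |: D).
    have -> : x |: D = (x |: B) :|: (D :\: B).
      apply/setP => y; rewrite !inE; have := subsetP BD y.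
      by case: (y \in B) => [/(_ isT)->|_] /=; rewrite ?orbF ?orbT.
    apply: partitionU1; first exact: partitionD1.
      by apply/set0Pn; exists x; rewrite !inE eqxx.
    rewrite -setI_eq0; apply/eqP/setP => y; rewrite !inE.
    by have [->|_] := eqVneq y x; [rewrite (negPf xD) andbF | case: (y \in B)].
  have blk : pblock ((x |: B) |: (P :\ B)) x = x |: B.
    by apply: def_pblock; rewrite ?(partition_trivIset pf) // !inE eqxx.
  rewrite blk !setU1K // setD1K //; split=> //.
  rewrite pf cardsU1 xBP /=; move: cP; rewrite (cardsD1 B) BP => -> /=.
  (* The singleton of [x] is not the enlarged block, as [B] is nonempty, nor an old block, as [x] is
     outside [D]. *)
  rewrite negb_or; apply/andP; split.
    have /set0Pn[y yB] := partition_neq0 pP BP.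
    apply/eqP => /setP/(_ y); rewrite !inE yB orbT => /eqP yx.
    by rewrite -yx yB in xB.
  rewrite negb_and; apply/orP; right; apply: contra xD => xP.
  by have := partitionS pP xP; rewrite sub1set.
move=> Q; rewrite !inE => /andP[/andP[pQ cQ] sQ] /=.
set B := pblock Q x.
have xcov : x \in cover Q by rewrite (cover_partition pQ) !inE eqxx.
have BQ : B \in Q by apply: pblock_mem.
have xB : x \in B by rewrite mem_pblock.
have BD := partitionS pQ BQ.
(* Otherwise [B] would be the excluded singleton block. *)
have B'0 : B :\ x != set0.
  apply: contra sQ; rewrite setD_eq0 => Bx.
  by have <- : B = [set x] by apply/eqP; rewrite eqEsubset Bx sub1set.
have pQ' := partitionD1 pQ BQ.
have B'Q : B :\ x \notin Q :\ B.
  apply/negP => /(partitionS pQ')/subsetP sub; case/set0Pn: B'0 => y yB.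
  by have := sub y yB; move: yB; rewrite !inE => /andP[_ ->].
rewrite setU1K // setD1K // setD1K //; split=> //.
rewrite cardsU1 B'Q; move: cQ; rewrite (cardsD1 B) BQ => ->.
rewrite eqxx orTb !andbT.
have <- : (B :\ x) :|: ((x |: D) :\: B) = D.
  apply/setP => y; rewrite !inE; have [->|yx] := eqVneq y x; first by rewrite xB (negPf xD).
  have := subsetP BD y; rewrite !inE (negPf yx) /=.
  by case: (y \in B) => // /(_ isT)->.
apply: partitionU1 => //; rewrite -setI_eq0; apply/eqP/setP => y; rewrite !inE.
by case: (y \in B); rewrite ?andbF.
Qed.

Lemma card_partitionsU1 (T : finType) (x : T) (D : {set T}) j : x \notin D ->
  #|partitions (x |: D) j.+1| = #|partitions D j| + j.+1 * #|partitions D j.+1|.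
Proof.
move=> xD; rewrite -(card_partitions_with_singleton j xD) -(card_partitions_without_singleton j xD).
rewrite -(cardsID [set Q : {set {set T}} | [set x] \in Q]).
by congr (_ + _); apply: eq_card => Q; rewrite !inE // andbC.
Qed.

Lemma card_partitions0 (T : finType) (D : {set T}) :
  #|partitions D 0| = (D == set0).
Proof.
have [->|D0] := eqVneq D set0.
  apply/eqP/cards1P; exists set0; apply/setP => P.
  by rewrite !inE partition_set0 cards_eq0 andbb.
apply: eq_card0 => P; rewrite !inE cards_eq0; apply: contraNF D0 => /andP[pP /eqP P0].
by rewrite -(cover_partition pP) P0 /cover big_set0.
Qed.

Lemma card_partitions_set0 (T : finType) j : #|partitions (set0 : {set T}) j| = (j == 0).
Proof.
case: j => [|j]; first by rewrite card_partitions0 eqxx.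
apply: eq_card0 => P; rewrite !inE partition_set0.
by case: eqP => // ->; rewrite cards0.
Qed.

Fixpoint stirling_rec m j :=
  match m, j with
  | 0, 0 => 1
  | m'.+1, j'.+1 => stirling_rec m' j' + j * stirling_rec m' j
  | _, _ => 0
  end.

Lemma card_partitions (T : finType) (D : {set T}) j : #|partitions D j| = stirling_rec #|D| j.
Proof.
move cD: #|D| => m; elim: m D cD j => [|m IH] D cD j.
  by rewrite (cards0_eq cD) card_partitions_set0; case: j.
have D0 : D != set0 by rewrite -cards_eq0 cD.
case: j => [|j]; first by rewrite card_partitions0 (negPf D0).
have /set0Pn[x xD] := D0; move: cD; rewrite (cardsD1 x) xD => -[cD].
by rewrite -{1}(setD1K xD) card_partitionsU1 ?inE ?eqxx // !IH.
Qed.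

Lemma stirling2E m j : stirling2 (Posz m) j = stirling_rec m j.
Proof. by rewrite /stirling2 -/(partitions _ _) card_partitions cardsT card_ord. Qed.

(** * The closed form *)

Lemma num_typed_n0 j : num_typed 0 j 0 = (j == 0).
Proof.
have E (P : pred 'I_0) : #|[set i | P i]| = 0 by apply: eq_card0 => -[].
transitivity (\sum_(s : 'S_0) (j == 0)).
  apply: eq_bigr => s _; rewrite /typed !E eq_sym eqxx andbT.
  by have -> : avoids_b3b1542 s by apply/avoidsP => -[].
rewrite sum_nat_const (_ : #|_| = 1) ?mul1n // -[RHS](card_Sn 0).
by apply: eq_card => s; rewrite !inE.
Qed.

(** The counting recurrence reaches back two lengths, hence the strong induction; its factor j+1
    turns j! into (j+1)! and leaves the Stirling recurrence. *)
Lemma num_typed0 n j :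
  num_typed n j 0 = if j <= n then j`! * stirling_rec (n - j) j else 0.
Proof.
elim/ltn_ind: n j => -[|n] IH [|j]; rewrite ?num_typed_n0 // num_typed0S // ltnS.
case: n IH => [|n] IH.
  (* In length one the only maximum is flat, so both sides vanish. *)
  rewrite big1 ?muln0 => [|s _]; first by case: j => [|j]; rewrite ?muln0.
  by rewrite /extendable (_ : #|_| = 0) ?andbF //; apply: eq_card0 => -[].
rewrite num_extendable !IH // subSS.
have [jn|jn|->] := ltngtP j n.+1.
- rewrite ltnS in jn; rewrite jn subSn //= subSS factS; lia.
- by rewrite [j <= n]leqNgt (ltnW jn) addn0 muln0.
by rewrite ltnn subnn addn0 !muln0.
Qed.

Theorem theorem1 (n j k : nat) :
  #|[set s : 'S_n | [&& avoids_b3b1542 s,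
       #|[set i | ltr_max s i]| == j + k,
       #|[set i | ltr_max s i & initiates_descent s i]| == j &
       #|[set i | ltr_max s i & ~~ initiates_descent s i]| == k]]|
  = 'C(n, k) * j`! * stirling2 (n%:Z - j%:Z - k%:Z)%R j.
Proof.
transitivity (num_typed n j k).
  rewrite card_set_sum; apply: eq_bigr => s _; rewrite /typed card_ltr_max.
  congr (nat_of_bool (_ && _)); apply/and3P/andP => [[]|[/eqP d /eqP f]] //.
  by rewrite d f; split.
rewrite num_typed_bin num_typed0.
have [kn|nk] := leqP k n; last by rewrite bin_small.
rewrite -mulnA; congr (_ * _); case: leqP => [jn|nj].
  have -> : (n%:Z - j%:Z - k%:Z)%R = Posz (n - k - j) by lia.
  by rewrite stirling2E.
(* Here n-j-k is negative, and [stirling2] is 0 by convention. *)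
case E : (n%:Z - j%:Z - k%:Z)%R => [p|p] /=; last by rewrite muln0.
by exfalso; move: E; lia.
Qed.
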